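(* Every graph (in particular, every connected graph) that contains at most one cycle has property ( * ).
   Context: All graphs are finite, undirected, and simple. An anticlique is a set of pairwise nonadjacent vertices. A coloring of a graph $G$ is a partition $\mathfrak{C}$ of $V(G)$ into anticliques (nonempty, called color classes). A transversal of $\mathfrak{C}$ is a set $T$ containing exactly one element of each member of $\mathfrak{C}$ and nothing else. A Kempe chain is a connected component of $G[A\cup B]$ for some $A\neq B$ from $\mathfrak{C}$. The routing graph $H(G,\mathfrak{C},T)$ is the graph on vertex set $T$ in which two distinct $s,t\in T$ are adjacent if and only if they belong to the same Kempe chain in $G$ (equivalently, there is an $s$,$t$-path in $G[A\cup B]$ where $A,B\in\mathfrak{C}$ are the classes containing $s,t$). For a graph $H$ with $V(H)\subseteq V(G)$, a rooted $H$-certificate in $G$ is a family $(V_t)_{t\in V(H)}$ of pairwise disjoint subsets of $V(G)$ (bags) such that $t\in V_t$ and $G[V_t]$ is connected for all $t\in V(H)$, and for every $st\in E(H)$ there is an edge of $G$ connecting $V_s$ and $V_t$. A graph $K$ has property ( * ) if for every graph $G$, every coloring $\mathfrak{C}$ of $G$ with $|\mathfrak{C}|=|V(K)|$, every transversal $T$ of $\mathfrak{C}$, and every spanning subgraph $H$ of $H(G,\mathfrak{C},T)$ isomorphic to $K$, there exists a rooted $H$-certificate in $G$. *)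

(* Defs.v *)
From mathcomp Require Import all_boot.

Set Implicit Arguments.
Unset Strict Implicit.
Unset Printing Implicit Defensive.

Record sgraph (V : finType) := SGraph {
  adj :> rel V;
  adj_sym : symmetric adj;
  adj_irr : irreflexive adj }.

Section Graphs.
Variables (V : finType) (G : sgraph V).

Definition induced_adj (A : {set V}) : rel {x : V | x \in A} :=
  fun x y => G (val x) (val y).

Lemma induced_sym A : symmetric (@induced_adj A).
Proof. by move=> x y; apply: adj_sym. Qed.

Lemma induced_irr A : irreflexive (@induced_adj A).
Proof. by move=> x; apply: adj_irr. Qed.

Definition induced (A : {set V}) : sgraph {x : V | x \in A} :=
  SGraph (@induced_sym A) (@induced_irr A).

(* This holds for the graph without vertices; it is only applied below to
   induced subgraphs with at least one vertex. *)
Definition connected_graph : Prop := forall x y : V, connect G x y.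

Definition components : {set {set V}} :=
  [set [set y | connect G x y] | x in [set: V]].

Definition anticlique (A : {set V}) : bool :=
  [forall x in A, forall y in A, ~~ G x y].

Definition coloring (C : {set {set V}}) : bool :=
  partition C [set: V] && [forall A in C, anticlique A].

Definition is_cycle (c : seq V) : Prop := ucycle G c /\ 2 < size c.

Definition cycle_edges (c : seq V) : {set {set V}} :=
  [set [set x; next c x] | x in c].

(* A cycle is a subgraph, whereas a sequence also records a starting point and
   a direction; two sequences describe the same subgraph iff they have the same
   edge set (which determines the vertex set). *)
Definition at_most_one_cycle : Prop :=
  forall c d : seq V, is_cycle c -> is_cycle d -> cycle_edges c = cycle_edges d.

End Graphs.

Definition isomorphic (U V : finType) (K : sgraph U) (H : sgraph V) : Prop :=
  exists2 f : U -> V, bijective f & forall x y, H (f x) (f y) = K x y.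

(* Both graphs having the vertex set V, "subgraph" here means spanning. *)
Definition spanning_subgraph (V : finType) (H R : sgraph V) : Prop :=
  subrel H R.

Section Routing.
Variables (V : finType) (G : sgraph V).

Definition kempe_chain (C : {set {set V}}) (X : {set V}) : bool :=
  [exists A in C, exists B in C, (A != B) &&
    [exists Y in components (induced G (A :|: B)), X == [set val x | x in Y]]].

Definition routing_adj (C : {set {set V}}) (T : {set V}) :
    rel {x : V | x \in T} :=
  fun s t => (s != t) &&
    [exists X : {set V}, [&& kempe_chain C X, val s \in X & val t \in X]].

Lemma routing_sym C T : symmetric (@routing_adj C T).
Proof.
move=> s t; rewrite /routing_adj eq_sym; congr (_ && _).
by apply: eq_existsb => X; rewrite [(val s \in X) && _]andbC.
Qed.

Lemma routing_irr C T : irreflexive (@routing_adj C T).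
Proof. by move=> s; rewrite /routing_adj eqxx. Qed.

Definition routing_graph (C : {set {set V}}) (T : {set V}) :
    sgraph {x : V | x \in T} :=
  SGraph (@routing_sym C T) (@routing_irr C T).

(* A graph H with V(H) a set S of vertices of G is a graph on the subtype S. *)
Definition rooted_certificate (S : {set V}) (H : sgraph {x : V | x \in S})
    (bag : {x : V | x \in S} -> {set V}) : Prop :=
  [/\ forall s t, s != t -> [disjoint bag s & bag t],
      forall t, val t \in bag t,
      forall t, connected_graph (induced G (bag t)) &
      forall s t, H s t -> exists x y, [/\ x \in bag s, y \in bag t & G x y]].

End Routing.

Definition property_star (U : finType) (K : sgraph U) : Prop :=
  forall (V : finType) (G : sgraph V) (C : {set {set V}}) (T : {set V})
         (H : sgraph {x : V | x \in T}),
    coloring G C -> #|C| = #|U| ->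
    is_transversal T C [set: V] ->
    spanning_subgraph H (routing_graph G C T) ->
    isomorphic K H ->
    exists bag, rooted_certificate G H bag.

(* Main.v *)
Require Import Defs.
From mathcomp Require Import all_boot zify.

Set Implicit Arguments.
Unset Strict Implicit.
Unset Printing Implicit Defensive.

(** Let every edge [st] of [K] be realized by a Kempe path between the roots of
    [s] and [t] inside their two color classes. The coloring enters through the
    following: paths of disjoint edges are disjoint, and paths of two edges at
    [s] meet only in the class of [s].

    If [K] has a leaf [l] with neighbor [s], take a path from the root of [l] to
    the root of [s] and contract all of it but its first vertex into the root of
    [s]. The remaining edges of [K] are still realized, because no other edge
    relies on the class of [l]; a certificate for [K] without the edge [ls] is
    lifted through the contraction, and [l] gets its root alone as a bag
    ([leaf_reduction]). By induction on the number of edges it remains to treat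
    graphs without leaves. When there is at most one cycle, such a graph
    has no edges or is a cycle plus isolated vertices: a bridge would separate
    two cycles ([cycle_of_no_leaf]).

    For a cycle with vertices 0, ..., n, let [p i] be the Kempe path from the
    root of [i] to that of its predecessor, and look for bags that are prefixes
    of these paths ([closed_chain_exists]). A prefix of [p 0] of length [f]
    determines the others greedily, each being the longest one that avoids the
    preceding bag; it is then adjacent to it, because the uncut path would hit
    that bag. Cutting one bag longer makes the next one shorter or leaves it
    unchanged, so the lengths of the greedy family respond to [f] alternately in
    opposite directions. Only the bags of [n] and 0 need not fit together. They
    are disjoint for [f = 1] and overlap when [p 0] is not cut, so there is a
    last [f] before the first overlap; a discrete intermediate value argument
    between the families for [f] and [f.+1] then gives a family that closes up
    ([interpolate]). *)

(** * Connection inside vertex sets and rooted models *)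

Definition within {V : finType} (e : rel V) (B : {set V}) : rel V :=
  fun x y => [&& x \in B, y \in B & e x y].

Section Within.
Variables (V : finType) (e : rel V).
Hypothesis e_sym : symmetric e.

Lemma within_sym B : symmetric (within e B).
Proof. by move=> x y; rewrite /within e_sym andbCA. Qed.

Lemma connect_within_sym B : connect_sym (within e B).
Proof. exact/sym_connect_sym/within_sym. Qed.

Lemma within_path (B : {set V}) x p : x \in B ->
  path (within e B) x p = path e x p && all [in B] p.
Proof.
elim: p x => //= y p IH x xB; rewrite /within xB /=.
by case: (boolP (y \in B)) => yB; rewrite ?andbF //= IH // andbA.
Qed.

Lemma path_connect_within x p y : path e x p -> y \in x :: p ->
  connect (within e [set z in x :: p]) x y.
Proof.
move=> px yp; apply: (path_connect (p := p)) => //.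
rewrite within_path ?inE ?eqxx // px /=; apply/allP => z zp.
by rewrite !inE zp orbT.
Qed.

End Within.

(** The color classes become arbitrary pairwise disjoint sets [cls u], and the
    graph an arbitrary symmetric relation [e]: contracting a connected set may
    join vertices of one class and create loops. *)
Definition rooted_model {U V : finType} (K : rel U) (e : rel V) (t : U -> V)
    (bag : U -> {set V}) : Prop :=
  [/\ forall u v, u != v -> [disjoint bag u & bag v],
      forall u, t u \in bag u,
      forall u x, x \in bag u -> connect (within e (bag u)) (t u) x &
      forall u v, K u v -> exists x y, [/\ x \in bag u, y \in bag v & e x y]].

Definition linked {U V : finType} (K : rel U) (e : rel V) (cls : U -> {set V})
    (t : U -> V) : Prop :=
  forall u v, K u v -> connect (within e (cls u :|: cls v)) (t u) (t v).

Section DeleteEdge.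
Variables (U : finType) (K : sgraph U) (a b : U).

Definition del_edge_adj : rel U :=
  fun u v => K u v && ([set u; v] != [set a; b]).

Lemma del_edge_sym : symmetric del_edge_adj.
Proof. by move=> u v; rewrite /del_edge_adj adj_sym (setUC [set u]). Qed.

Lemma del_edge_irr : irreflexive del_edge_adj.
Proof. by move=> u; rewrite /del_edge_adj adj_irr. Qed.

Definition del_edge : sgraph U := SGraph del_edge_sym del_edge_irr.

End DeleteEdge.

(** * Removing a leaf *)

Section Leaf.
Variables (U V : finType) (K : sgraph U) (e : rel V).
Variables (cls : U -> {set V}) (t : U -> V).
Hypothesis e_sym : symmetric e.
Hypothesis cls_inj : forall u v x, x \in cls u -> x \in cls v -> u = v.
Hypothesis t_cls : forall u, t u \in cls u.
Variables l s : U.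
Hypothesis Kls : K l s.
Hypothesis l_leaf : forall v, K l v -> v = s.
Variable X : {set V}.
Hypothesis tsX : t s \in X.
Hypothesis tlX : t l \notin X.
Hypothesis X_cls : X \subset cls l :|: cls s.
Hypothesis X_conn : forall x, x \in X -> connect (within e X) (t s) x.
Hypothesis X_adj : exists2 x, x \in X & e (t l) x.

(** The contraction of [X] to [t s], performed on the same vertex type: the
    vertices of [X] other than [t s] survive as isolated vertices of
    [collapsed]. The root of the leaf is made isolated too, which keeps it out
    of every bag but its own. *)
Definition collapse (x : V) : V := if x \in X then t s else x.

Definition collapsed : rel V :=
  fun x y => [exists x', exists y', [&& collapse x' == x, collapse y' == y,
     x' != t l, y' != t l & e x' y']].

Lemma collapsedP x y : reflect
  (exists x' y', [/\ collapse x' = x, collapse y' = y,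
     x' != t l, y' != t l & e x' y'])
  (collapsed x y).
Proof.
apply: (iffP existsP) => [[x' /existsP[y' /and5P[/eqP ? /eqP ? ? ? ?]]]|].
  by exists x', y'.
case=> x' [y' [hx hy ? ? ?]]; exists x'; apply/existsP; exists y'.
by rewrite hx hy !eqxx; apply/and5P.
Qed.

Lemma collapsed_sym : symmetric collapsed.
Proof.
move=> x y; apply/collapsedP/collapsedP => -[x' [y' [? ? ? ? ?]]];
  by exists y', x'; rewrite e_sym.
Qed.

Lemma t_inj : injective t.
Proof. by move=> u v uv; apply: (@cls_inj u v (t u)) => //; rewrite uv. Qed.

Lemma s_neq_l : s != l.
Proof. by apply/eqP => sl; have := Kls; rewrite sl adj_irr. Qed.

Lemma del_leaf u v : del_edge K l s u v -> [/\ K u v, u != l & v != l].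
Proof.
case/andP => Kuv ne; split=> //; apply/eqP => ?; subst.
  by case/eqP: ne; rewrite (l_leaf Kuv).
by case/eqP: ne; rewrite (l_leaf (v:=u)) ?(setUC [set s]) // adj_sym.
Qed.

Lemma collapse_t u : u != l -> collapse (t u) = t u.
Proof.
move=> ul; rewrite /collapse; case: ifP => // /(subsetP X_cls).
rewrite !inE => /orP[] tu; last by rewrite (@cls_inj u s (t u)).
by case/eqP: ul; apply: cls_inj tu.
Qed.

Lemma collapse_cls u x : u != l -> x \in cls u -> collapse x \in cls u.
Proof.
move=> ul xu; rewrite /collapse; case: ifP => // /(subsetP X_cls).
rewrite !inE => /orP[] xl; last by rewrite (@cls_inj u s x).
by case/eqP: ul; apply: cls_inj xl.
Qed.

(** The set [X] lies in the classes of [l] and [s], and [l] has lost its only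
    edge. So a path for an edge away from [s] avoids [X], and on a path for an
    edge at [s] the contraction only merges vertices of the class of [s]. *)
Lemma collapsed_linked : linked K e cls t ->
  linked (del_edge K l s) collapsed cls t.
Proof.
move=> lnk u v /del_leaf[Kuv ul vl]; have := lnk u v Kuv.
case/connectP => p; rewrite within_path ?inE ?t_cls // => /andP[pe pall] tv.
rewrite -(collapse_t ul) -(collapse_t vl) tv.
have tu : t u \in cls u :|: cls v by rewrite inE t_cls.
elim: p (t u) tu pe pall {tv} => //= y p IH x xin /andP[exy py] /andP[yin pin].
apply: connect_trans (IH _ yin py pin).
have not_l z : z \in cls u :|: cls v -> z != t l.
  by move=> zin; apply/eqP => zl; move: zin; rewrite zl inE => /orP[] h;
     [case/eqP: ul|case/eqP: vl]; apply: cls_inj h _.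
have coll z : z \in cls u :|: cls v -> collapse z \in cls u :|: cls v.
  by rewrite !inE => /orP[] /collapse_cls ->; rewrite ?orbT.
apply: connect1; rewrite /within !coll //=.
by apply/collapsedP; exists x, y; rewrite !not_l.
Qed.

(** Preimages of connected sets under a contraction are connected, because the
    fibres are connected and every edge of the contracted graph lifts. *)
Lemma collapse_expand (B : {set V}) x y :
  collapse x \in B -> connect (within collapsed B) (collapse x) (collapse y) ->
  connect (within e (collapse @^-1: B)) x y.
Proof.
have fibre x1 y1 : collapse x1 \in B -> collapse x1 = collapse y1 ->
    connect (within e (collapse @^-1: B)) x1 y1.
  move=> x1B eq1; case: (eqVneq x1 y1) => [->//|ne].
  (* The only fibre with several elements is [X], which is connected. *)
  have [tsB x1X y1X] : [/\ t s \in B, x1 \in X & y1 \in X].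
    move: x1B eq1 ne; rewrite /collapse.
    case: (boolP (x1 \in X)) => x1X; case: (boolP (y1 \in X)) => y1X //.
    - by move=> _ eq1; rewrite -eq1 tsX in y1X.
    - by move=> _ eq1; rewrite eq1 tsX in x1X.
    - by move=> _ ->; rewrite eqxx.
  have sub : subrel (connect (within e X)) (connect (within e (collapse @^-1: B))).
    apply: connect_sub => a b /and3P[aX bX eab]; apply: connect1.
    by rewrite /within !inE /collapse aX bX tsB.
  apply: sub; apply: connect_trans (X_conn y1X).
  by rewrite connect_within_sym //; apply: X_conn.
move=> xB /connectP[p]; rewrite within_path // => /andP[pe pall].
elim: p x xB pe pall => [|b p IH] x xB /=; first by move=> _ _ /esym; apply: fibre.
case/andP=> /collapsedP[x' [y' [xx' yy' _ _ exy]]] pb /andP[bB pall].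
rewrite -yy' in pb bB *; move=> lst.
have xx'c : connect (within e (collapse @^-1: B)) x x' by apply: fibre.
apply: connect_trans xx'c (connect_trans _ (IH y' bB pb pall lst)).
by apply: connect1; rewrite /within !inE xx' xB bB.
Qed.

(** The leaf can be given the bag [[set t l]], since the expanded bag of its
    neighbor contains all of [X] and thereby a neighbor of [t l]. *)
Lemma leaf_extend bag' : rooted_model (del_edge K l s) collapsed t bag' ->
  exists bag, rooted_model K e t bag.
Proof.
case=> dis root conn adjc.
have l_notin u : u != l -> t l \notin bag' u.
  move=> ul; apply/negP => /conn.
  rewrite connect_within_sym; last exact: collapsed_sym.
  case/connectP => [[|z p]] /=.
    by move=> _ /t_inj ulE; rewrite ulE eqxx in ul.
  case/andP => /and3P[_ _ /collapsedP[x' [y' [xl _ x'l _ _]]]] _ _.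
  move: xl x'l; rewrite /collapse; case: ifP => [_ /t_inj sl|_ ->].
    2: by rewrite eqxx.
  by move: s_neq_l; rewrite sl eqxx.
have coll_l : collapse (t l) = t l by rewrite /collapse (negPf tlX).
have ts_bag : X \subset collapse @^-1: bag' s.
  by apply/subsetP => x xX; rewrite inE /collapse xX.
exists (fun u => if u == l then [set t l] else collapse @^-1: bag' u); split.
- move=> u v uv; case: (eqVneq u l) uv => [->|ul] uv;
    case: (eqVneq v l) uv => [vl|vl] uv.
  + by [].
  + by rewrite disjoints1 inE coll_l l_notin.
  + by rewrite disjoint_sym disjoints1 inE coll_l l_notin.
  + rewrite -setI_eq0 -preimsetI; have := dis u v uv.
    by rewrite -setI_eq0 => /eqP->; rewrite preimset0.
- move=> u; case: (eqVneq u l) => [->|ul]; first by rewrite inE.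
  by rewrite inE collapse_t.
- move=> u x; case: (eqVneq u l) => [->|ul]; first by rewrite inE => /eqP->.
  rewrite inE => xu; apply: collapse_expand; rewrite collapse_t //.
  exact: conn.
- have [x0 x0X lx0] := X_adj.
  have sX : x0 \in collapse @^-1: bag' s by apply: (subsetP ts_bag).
  move=> u v; case: (eqVneq u l) => [->|ul].
    move=> /l_leaf->; rewrite (negPf s_neq_l).
    by exists (t l), x0; rewrite inE.
  case: (eqVneq v l) => [->|vl] Kuv.
    rewrite adj_sym in Kuv; rewrite (l_leaf Kuv).
    by exists x0, (t l); rewrite inE eqxx e_sym.
  have [|x [y [xu yv /collapsedP[x' [y' [xx' yy' _ _ exy]]]]]] := adjc u v.
    rewrite /= /del_edge_adj Kuv; apply/eqP => eqs.
    by have := set21 l s; rewrite -eqs !inE ![l == _]eq_sym (negPf ul) (negPf vl).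
  by exists x', y'; rewrite !inE xx' yy'.
Qed.
End Leaf.

(** The set to contract is what remains of a Kempe path from [t l] to [t s]
    when its first vertex is dropped. Its vertices in the class of [l] are free
    to use, because no other edge of [K] relies on that class. *)
Lemma leaf_reduction (U V : finType) (K : sgraph U) (e : rel V)
    (cls : U -> {set V}) (t : U -> V) l s :
  symmetric e -> (forall u v x, x \in cls u -> x \in cls v -> u = v) ->
  (forall u, t u \in cls u) -> linked K e cls t ->
  K l s -> (forall v, K l v -> v = s) ->
  exists e' : rel V, [/\ symmetric e', linked (del_edge K l s) e' cls t &
    (exists bag, rooted_model (del_edge K l s) e' t bag) ->
    exists bag, rooted_model K e t bag].
Proof.
move=> e_sym cls_inj t_cls lnk Kls l_leaf.
have ls_dif : t l != t s.
  apply/eqP => ts; have ls : l = s by apply: (cls_inj l s (t l)); last rewrite ts.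
  by move: Kls; rewrite ls adj_irr.
have /connectP[p0 pth0 lst0] := lnk l s Kls.
case: (shortenP pth0) lst0 => p pth uniq_p _ lst {p0 pth0}.
move: pth; rewrite within_path ?inE ?t_cls // => /andP[pe /allP p_cls].
case: p pe lst uniq_p p_cls => [|x p].
  by move=> _ ls; rewrite ls eqxx in ls_dif.
move=> /= /andP[elx px] lst /andP[lp _] p_cls.
pose X := [set z in x :: p].
have tsX : t s \in X by rewrite inE lst mem_last.
have tlX : t l \notin X by rewrite inE.
have X_cls : X \subset cls l :|: cls s.
  by apply/subsetP => z; rewrite [z \in X]inE => /p_cls.
have X_conn z : z \in X -> connect (within e X) (t s) z.
  rewrite inE => zX; apply: (@connect_trans _ _ x).
  2: exact: path_connect_within px zX.
  rewrite connect_within_sym // lst; apply: path_connect_within px _.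
  exact: mem_last.
have X_adj : exists2 z, z \in X & e (t l) z by exists x; rewrite // inE mem_head.
exists (collapsed e t l s X); split.
- exact: collapsed_sym.
- exact: (collapsed_linked cls_inj t_cls l_leaf X_cls).
- case=> bag.
  exact: (leaf_extend e_sym cls_inj t_cls Kls l_leaf tsX tlX X_cls X_conn X_adj).
Qed.

(** * Leafless graphs with at most one cycle *)

Lemma sub_is_cycle (U : finType) (K L : sgraph U) c :
  subrel L K -> is_cycle L c -> is_cycle K c.
Proof.
by move=> sub [/andP[cyc uc] sz]; split=> //; rewrite /ucycle (sub_cycle sub).
Qed.

Lemma cover_cycle_edges (U : finType) (c : seq U) :
  cover (cycle_edges c) = [set x in c].
Proof.
apply/setP => x; rewrite inE; apply/bigcupP/idP => [[A /imsetP[z zc ->]]|xc].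
  by rewrite !inE => /pred2P[] ->; rewrite ?mem_next.
by exists [set x; next c x]; rewrite ?set21 //; apply/imsetP; exists x.
Qed.

Section Structure.
Variables (U : finType) (K : sgraph U).

Lemma edge_on_cycle x y : K x y -> connect (del_edge K x y) x y ->
  exists2 c, is_cycle K c & [set x; y] \in cycle_edges c.
Proof.
move=> Kxy /connectP[p0 pth0 lst0].
case: (shortenP pth0) lst0 => p pth uniq_p _ lst {p0 pth0}.
have pthK : path K x p by apply: sub_path pth => u v /andP[].
have ne : x != y by apply: contraTneq Kxy => ->; rewrite adj_irr.
exists (x :: p).
  split; first by rewrite /ucycle uniq_p andbT /= rcons_path pthK -lst adj_sym.
  case: p pth lst {uniq_p pthK} => [|z [|//]] /=.
    by move=> _ xy; rewrite xy eqxx in ne.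
  by rewrite andbT => /andP[_ /eqP zx] yz; case: zx; rewrite yz.
apply/imsetP; exists y; first by rewrite lst mem_last.
suff -> : next (x :: p) y = x by rewrite setUC.
rewrite next_nth lst mem_last.
have -> : index (last x p) (x :: p) = size p by rewrite index_last.
by rewrite nth_default.
Qed.

Hypothesis no_leaf : forall u v, K u v -> exists2 w, K u w & w != v.

(** Without leaves, a walk that has entered [y] from [x] can always go on
    without turning back, so it closes up: either at [x], or in a cycle that is
    reached from [y] without using the edge [xy]. *)
Lemma cycle_beyond x y : K x y -> connect (del_edge K x y) x y \/
  exists2 c, is_cycle K c & {subset c <= connect (del_edge K x y) y}.
Proof.
move=> Kxy.
have near z q v : path K z q -> last z q = y -> x \notin z :: q ->
    v \in z :: q -> connect (del_edge K x y) y v.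
  move=> pq lq xq vq.
  have sym : connect_sym (del_edge K x y) by apply/sym_connect_sym/adj_sym.
  have pd : path (del_edge K x y) z q.
    have qx : all (predC1 x) (z :: q).
      by apply/allP => u uq /=; apply: contraNneq xq => <-.
    refine (sub_in_path _ qx pq) => u w; rewrite !inE => ux wx Kuw.
    rewrite /= /del_edge_adj Kuw; apply/eqP => eqs.
    by have := set21 x y; rewrite -eqs !inE ![x == _]eq_sym (negPf ux) (negPf wx).
  apply: (@connect_trans _ _ z); last exact: path_connect pd _ vq.
  by rewrite sym; apply: (path_connect pd); rewrite -lq; apply: mem_last.
(* The path [z :: q] is stored backwards, from its current end [z] to [y], so
   the vertex visited before [z] is [head x q]. *)
have grow m : forall z q, #|U| - size q <= m -> path K z q -> last z q = y ->
   uniq (z :: q) -> x \notin z :: q -> connect (del_edge K x y) x y \/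
   exists2 c, is_cycle K c & {subset c <= connect (del_edge K x y) y}.
  elim: m => [|m IH] z q le_m pq lq uq xq;
    have szU : size (z :: q) <= #|U| by rewrite -(card_uniqP uq) max_card.
    by move: le_m; rewrite leqn0 subn_eq0 leqNgt szU.
  have Kza : K z (head x q).
    case: q pq lq {le_m uq xq szU} => [|b q] /= => [_ ->|/andP[]//].
    by rewrite adj_sym.
  have [w Kzw wa] := no_leaf Kza.
  have [wx|wx] := eqVneq w x.
    left; rewrite wx in Kzw wa.
    have zy : z != y.
      case: q lq wa uq {le_m pq xq Kza szU} => [|b q] /=; first by rewrite eqxx.
      by move=> <- _ /andP[+ _]; apply: contraNneq => ->; apply: mem_last.
    apply: (@connect_trans _ _ z); last first.
      have sym : connect_sym (del_edge K x y) by apply/sym_connect_sym/adj_sym.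
      by rewrite sym; apply: near pq lq xq _; rewrite mem_head.
    apply: connect1; rewrite /= /del_edge_adj adj_sym Kzw; apply/eqP => eqs.
    have := set22 x z; rewrite eqs !inE (negPf zy) orbF => /eqP zx.
    by rewrite zx mem_head in xq.
  have [wq|wq] := boolP (w \in q); last first.
    apply: (IH w (z :: q)) => //=.
    - by rewrite subnS; case: (_ - _) le_m.
    - by rewrite adj_sym Kzw.
    - rewrite inE negb_or wq andbT; move: uq => /= ->; rewrite andbT.
      by apply: contraTneq Kzw => ->; rewrite adj_irr.
    - by rewrite inE negb_or eq_sym wx.
  right; case/splitPr: wq pq uq lq xq wa Kza {szU le_m} => q1 q2 pq uq lq xq wa Kza.
  exists (z :: rcons q1 w).
    split; last first.
      by case: q1 wa {pq uq lq xq Kza} => [|b q1] /=; rewrite ?eqxx // size_rcons.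
    apply/andP; split.
      rewrite /= rcons_path last_rcons [K w z]adj_sym Kzw andbT.
      by move: pq; rewrite -cat_rcons cat_path => /andP[].
    by move: uq; rewrite -cat_rcons -cat_cons cat_uniq => /andP[].
  move=> v vc; apply: near pq lq xq _; rewrite -cat_rcons -cat_cons mem_cat.
  by rewrite vc.
have [] := grow #|U| y [::] => //=; first exact: leq_subr.
- by rewrite inE; apply: contraTneq Kxy => ->; rewrite adj_irr.
- by left.
- by right.
Qed.

End Structure.

Lemma del_edgeC (U : finType) (K : sgraph U) x y :
  del_edge K x y =2 del_edge K y x.
Proof. by move=> u v; rewrite /= /del_edge_adj (setUC [set x]). Qed.

(** By [cycle_beyond], applied to both directions of [xy], there would
    otherwise be a cycle on either side of the bridge [xy]. There is only one
    cycle, so it joins the two sides. *)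
Lemma all_edges_on_cycle (U : finType) (K : sgraph U) x y :
  at_most_one_cycle K ->
  (forall u v, K u v -> exists2 w, K u w & w != v) -> K x y ->
  exists2 c, is_cycle K c & [set x; y] \in cycle_edges c.
Proof.
move=> one no_leaf Kxy; apply: edge_on_cycle => //.
have Kyx : K y x by rewrite adj_sym.
have sym : connect_sym (del_edge K x y) by apply/sym_connect_sym/adj_sym.
have [//|[c cyc cy]] := cycle_beyond no_leaf Kxy.
have [|[d cyd dx]] := cycle_beyond no_leaf Kyx.
  by rewrite -(eq_connect (del_edgeC K x y)) sym.
have [v vc] : exists v, v \in c.
  by case: c cyc {cy} => [[]//|v c _]; exists v; apply: mem_head.
have vd : v \in d.
  have /setP/(_ v) : [set z in d] = [set z in c].
    by rewrite -!cover_cycle_edges (one c d).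
  by rewrite !inE vc.
apply: (@connect_trans _ _ v); last by rewrite sym; apply: cy.
by rewrite (eq_connect (del_edgeC K x y)); apply: dx.
Qed.

Lemma cycle_of_no_leaf (U : finType) (K : sgraph U) x y :
  at_most_one_cycle K ->
  (forall u v, K u v -> exists2 w, K u w & w != v) -> K x y ->
  exists2 c, is_cycle K c & forall u v, K u v -> [set u; v] \in cycle_edges c.
Proof.
move=> one no_leaf /(all_edges_on_cycle one no_leaf)[c cyc _].
exists c => // u v /(all_edges_on_cycle one no_leaf)[d cyd].
by rewrite (one c d).
Qed.

(** * Disjoint prefixes of a cyclic sequence of paths *)

(** The path [p i.+1] leads from [t i.+1] to [t i], and [p 0] from [t 0] to
    [t n]. The aim is to cut each path to a prefix so that cyclically
    consecutive prefixes are disjoint and adjacent. *)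
Section CyclicPaths.
Variables (V : finType) (e : rel V) (n : nat) (p : nat -> seq V) (t : nat -> V).
Hypothesis e_sym : symmetric e.
Hypothesis p_sorted : forall i, i <= n -> sorted e (p i).
Hypothesis p_head : forall i, i <= n -> ohead (p i) = Some (t i).
Hypothesis p_last : forall i, i < n -> t i \in p i.+1.
Hypothesis p0_last : t n \in p 0.
Hypothesis p_root : forall i, i < n -> t i.+1 \notin p i.
Hypothesis pn_root : t 0 \notin p n.
Hypothesis p_triple : forall x, x \in p 0 -> x \in p 1 -> x \notin p n.

Definition touching (s1 s2 : seq V) : Prop :=
  ~~ has (mem s1) s2 /\ exists x y, [/\ x \in s1, y \in s2 & e x y].

Lemma touchingC s1 s2 : touching s1 s2 -> touching s2 s1.
Proof.
case=> dis [x [y [xs ys exy]]]; split; first by rewrite has_sym.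
by exists y, x; rewrite e_sym.
Qed.

Lemma touching_nth i s : i <= n -> 0 < find (mem s) (p i) < size (p i) ->
  touching s (take (find (mem s) (p i)) (p i)).
Proof.
move=> le_in /andP[f0 fs]; set f := find _ _ in f0 fs *.
split; first by rewrite has_take_leq ?ltnn // ltnW.
exists (nth (t 0) (p i) f), (nth (t 0) (p i) f.-1); split.
- by have := @nth_find _ (t 0) (mem s) (p i); apply; rewrite has_find.
- by apply/(nthP (t 0)); exists f.-1; rewrite ?size_take ?fs ?nth_take ?prednK.
- rewrite e_sym; have /(sortedP (t 0)) := p_sorted le_in.
  by move=> /(_ f.-1); rewrite prednK //; apply.
Qed.

Lemma root_prefix i m : i <= n -> 0 < m -> t i \in take m (p i).
Proof.
move=> /p_head; case: (p i) => //= x s [->]; case: m => // m _.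
by rewrite inE eqxx.
Qed.

(** Once [p 0] is cut to length [f], each path in turn is cut at the longest
    prefix that avoids the preceding one. These prefixes are consecutively
    disjoint and adjacent; only the pair formed by [n] and [0] may fail. *)
Fixpoint greedy (f i : nat) : nat :=
  if i is j.+1 then find (mem (take (greedy f j) (p j))) (p i) else f.

Lemma greedy_step f i : i < n -> 0 < greedy f i ->
  0 < greedy f i.+1 < size (p i.+1).
Proof.
move=> lt_in gt0; rewrite [greedy f i.+1]/= -has_find; apply/andP; split.
  have := p_head lt_in; have := p_root lt_in.
  case: (p i.+1) => //= x s not_t [xt]; rewrite xt.
  by rewrite (negPf (contra (@mem_take _ _ _ _) not_t)).
apply/hasP; exists (t i); first exact: p_last.
by apply: root_prefix gt0; apply: ltnW.
Qed.

Lemma greedy_bounds f i : 0 < f -> i < n ->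
  0 < greedy f i.+1 < size (p i.+1).
Proof.
move=> f0; elim: i => [|i IH] lt_in; apply: greedy_step => //.
by case/andP: (IH (ltnW lt_in)).
Qed.

Lemma greedy_gt0 f i : 0 < f -> i <= n -> 0 < greedy f i.
Proof. by case: i => // i f0 /(greedy_bounds f0)/andP[]. Qed.

Lemma greedy_size f i : 0 < f <= size (p 0) -> i <= n ->
  greedy f i <= size (p i).
Proof.
by case: i => [/andP[]//|i] /andP[f0 _] /(greedy_bounds f0)/andP[_ /ltnW].
Qed.

Lemma greedy_touching f i : 0 < f -> i < n ->
  touching (take (greedy f i) (p i)) (take (greedy f i.+1) (p i.+1)).
Proof. by move=> f0 lt_in; apply: touching_nth => //; apply: greedy_bounds. Qed.

Definition chain i (L : nat -> nat) : Prop := forall j, i <= j < n ->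
  touching (take (L j) (p j)) (take (L j.+1) (p j.+1)).

Definition closed_chain (L : nat -> nat) : Prop :=
  chain 0 L /\ touching (take (L 0) (p 0)) (take (L n) (p n)).

(** From index [i] on, [L] is already as wanted, also at the closing pair, and
    its [i]-th prefix lies between those of the greedy families for [a] and
    [b], which are [f] and [f.+1] in some order. If that prefix avoids the
    [i.-1]-th prefix of the family for [a], then it is the [i]-th prefix of that
    family, which therefore completes [L] below. Otherwise cut [p i.-1] at the
    longest prefix avoiding it: the result is shorter than the one for [a] but
    at least as long as the one for [b], so [a] and [b] swap roles and [i]
    decreases. At [i = 0] the length is squeezed between [f] and [f.+1]. *)
Lemma interpolate f i a b L : 0 < f < size (p 0) -> i <= n ->
  (a = f /\ b = f.+1) \/ (a = f.+1 /\ b = f) ->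
  chain i L -> greedy a i <= L i <= greedy b i ->
  touching (take f (p 0)) (take (L n) (p n)) ->
  touching (take f.+1 (p 0)) (take (L n) (p n)) ->
  exists L', closed_chain L'.
Proof.
move=> /andP[f0 fs]; elim: i a b L => [|i IH] a b L le_in ab chL bnd clf clf1.
  exists L; split=> //; move: bnd => /= bnd.
  by have [->|->] : L 0 = f \/ L 0 = f.+1 by lia.
have sa : 0 < a <= size (p 0) by lia.
have sb : 0 < b <= size (p 0) by lia.
have a0 : 0 < a by lia. have b0 : 0 < b by lia.
have Lsz : L i.+1 <= size (p i.+1).
  by apply: leq_trans (greedy_size sb le_in); case/andP: bnd.
case: (boolP (has (mem (take (greedy a i) (p i))) (take (L i.+1) (p i.+1)))).
  rewrite has_sym => meet.
  set m := find (mem (take (L i.+1) (p i.+1))) (p i).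
  have lt_m : m < greedy a i.
    by rewrite -has_take_leq // (greedy_size sa) // ltnW.
  have le_m : greedy b i <= m.
    rewrite leqNgt -has_take_leq; last by apply: greedy_size => //; exact: ltnW.
    have [dis _] := greedy_touching b0 le_in.
    apply: contra dis; rewrite has_sym => /hasP[x xL xg].
    apply/hasP; exists x => //.
    case/andP: bnd => _ le; move: xL; rewrite -(take_takel _ le).
    exact: mem_take.
  have m_gt0 : 0 < m by apply: leq_trans le_m; apply: greedy_gt0 => //; exact: ltnW.
  pose L' j := if j <= i then m else L j.
  have L'n : L' n = L n by rewrite /L' leqNgt le_in.
  apply: (IH b a L'); rewrite ?L'n //.
  - exact: ltnW.
  - tauto.
  - move=> j /andP[]; rewrite leq_eqVlt => /predU1P[<-|lt_ij] lt_jn.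
      rewrite /L' leqnn ltnn; apply/touchingC/touching_nth; first exact: ltnW.
      rewrite m_gt0 (leq_trans lt_m) //; apply: greedy_size => //; exact: ltnW.
    have [/negPf jN /negPf j1N] : ~~ (j <= i) /\ ~~ (j < i) by lia.
    by rewrite /L' jN j1N; apply: chL; rewrite lt_ij.
  - by rewrite /L' leqnn le_m ltnW.
rewrite has_take_leq // -leqNgt => le_La.
have eqL : L i.+1 = greedy a i.+1.
  by apply/eqP; rewrite eqn_leq le_La; case/andP: bnd.
exists (fun j => if j <= i then greedy a j else L j); split.
  move=> j /andP[_ lt_jn]; case: (ltngtP j i) => [lt_ji|lt_ij|ji].
  - exact: greedy_touching.
  - by apply: chL; rewrite lt_ij.
  - by rewrite ji eqL; apply: greedy_touching.
by rewrite [n <= i]leqNgt le_in /=; case: ab => [[-> _]|[-> _]].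
Qed.

(** Let [f.+1] be the first length whose greedy family overlaps at the closing
    pair, and [w] the vertex that the prefix of [p 0] gains from [f] on. If
    [w] is in the [n]-th prefix for [f], then this family is already closed.
    Otherwise the overlap is caused by the growth of the [n]-th prefix, which
    therefore has an intermediate length at which it becomes adjacent to the
    first prefix; interpolation starts there. *)
Lemma closed_chain_exists : 0 < n -> exists L, closed_chain L.
Proof.
move=> n0; pose bad f := has (mem (take f (p 0))) (take (greedy f n) (p n)).
have sz0 : 0 < size (p 0) by case: (p 0) (p_head (leq0n n)).
have ex_bad : exists f, bad f.
  exists (size (p 0)); rewrite /bad take_size; apply/hasP; exists (t n) => //.
  by apply: root_prefix => //; apply: greedy_gt0.
have [f' f'bad f'min] := ex_minnP ex_bad.
have le_f's : f' <= size (p 0).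
  apply: f'min; rewrite /bad take_size; apply/hasP; exists (t n) => //.
  by apply: root_prefix => //; apply: greedy_gt0.
have f'2 : 1 < f'.
  case: f' f'bad {f'min le_f's} => [|[|//]]; rewrite /bad.
    by case/hasP=> x _; rewrite take0.
  case/hasP=> x /mem_take; have := p_head (leq0n n).
  case: (p 0) => //= y s [yt] xn; rewrite take0 inE => /eqP xy.
  by case/negP: pn_root; rewrite -yt -xy.
case: f' f'2 f'bad f'min le_f's => // f f0 f_bad f_min f_s; rewrite ltnS in f0.
have f_ok : ~~ bad f by apply/negP => /f_min; rewrite ltnn.
have fb : 0 < f < size (p 0) by rewrite f0.
have f0' : 0 < f.+1 by [].
have sf : 0 < f <= size (p 0) by rewrite f0 ltnW.
have sf1 : 0 < f.+1 <= size (p 0) by [].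
set w := nth (t 0) (p 0) f.
have wp0 : w \in p 0 by rewrite mem_nth.
have take_f1 : take f.+1 (p 0) = rcons (take f (p 0)) w by rewrite -take_nth.
have adj_w : exists2 x, x \in take f (p 0) & e x w.
  exists (nth (t 0) (p 0) f.-1); last first.
    have /(sortedP (t 0)) /(_ f.-1) := p_sorted (leq0n n).
    by rewrite prednK //; apply.
  by apply/(nthP (t 0)); exists f.-1; rewrite ?size_take ?f_s ?nth_take ?prednK.
have [w_in|w_out] := boolP (w \in take (greedy f n) (p n)).
  exists (greedy f); split; first by move=> j /andP[_ ?]; apply: greedy_touching.
  by split=> //; have [x xf xw] := adj_w; exists x, w.
have bad_f :
    has (mem (take f (p 0))) (take (greedy f.+1 n) (p n)) && (w \notin p n).
  (* If [w] were on [p n], it would not be on [p 1], so that the two greedy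
     families would agree from index 1 on. *)
  have [wpn|wpn] := boolP (w \in p n).
    have same i : greedy f.+1 i.+1 = greedy f i.+1.
      elim: i => [|i /= -> //]; rewrite /= take_f1; apply: eq_in_find => x x1 /=.
      rewrite mem_rcons inE; case: eqP => // xw.
      by move: (p_triple wp0); rewrite -xw x1 xw => /(_ isT); rewrite wpn.
    move: f_bad; rewrite /bad take_f1; rewrite -(prednK n0) same prednK //.
    case/hasP=> x xn; rewrite /= mem_rcons inE => /predU1P[xw|xf].
      by rewrite -xw xn in w_out.
    by case/negP: f_ok; apply/hasP; exists x.
  rewrite andbT; move: f_bad; rewrite /bad take_f1 => /hasP[x xn] /=.
  rewrite mem_rcons inE => /predU1P[xw|xf]; last by apply/hasP; exists x.
  by rewrite -xw (mem_take xn) in wpn.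
case/andP: bad_f => meet wpn.
pose m := find (mem (take f (p 0))) (p n).
have lt_m : m < greedy f.+1 n by rewrite -has_take_leq // greedy_size.
have le_m : greedy f n <= m.
  by rewrite leqNgt -has_take_leq //; apply: greedy_size.
have m_touch : touching (take f (p 0)) (take m (p n)).
  apply: touching_nth => //; rewrite -/m (leq_trans (greedy_gt0 f0 _) le_m) //.
  exact: leq_trans lt_m (greedy_size sf1 _).
apply: (@interpolate f n f f.+1 (fun _ => m)) => //.
- by left.
- by move=> j /andP[le lt]; move: (leq_trans lt le); rewrite ltnn.
- by rewrite le_m ltnW.
case: m_touch => dis [x [y [xf ym exy]]]; split; last first.
  by exists x, y; rewrite take_f1 mem_rcons inE xf orbT.
apply/hasP => -[z zm]; rewrite /= take_f1 mem_rcons inE => /predU1P[zw|zf].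
  by rewrite -zw (mem_take zm) in wpn.
by case/negP: dis; apply/hasP; exists z.
Qed.

End CyclicPaths.

(** * Rooted certificates for cycles *)

Lemma set2_eq (T : finType) (a b c d : T) : a != b -> [set a; b] = [set c; d] ->
  (a = c /\ b = d) \/ (a = d /\ b = c).
Proof.
move=> ab eqs; have := set21 a b; have := set22 a b; rewrite eqs !inE.
by move=> /pred2P[] bE /pred2P[] aE; subst; rewrite ?eqxx in ab; auto.
Qed.

Lemma linked_paths (U V : finType) (K : rel U) (e : rel V)
    (cls : U -> {set V}) t :
  (forall u, t u \in cls u) -> linked K e cls t ->
  exists w : U * U -> seq V, forall uv, K uv.1 uv.2 ->
    [/\ path e (t uv.1) (w uv), last (t uv.1) (w uv) = t uv.2 &
        {subset t uv.1 :: w uv <= cls uv.1 :|: cls uv.2}].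
Proof.
move=> t_cls lnk; apply: (@fin_all_exists _ _ (fun uv q => K uv.1 uv.2 ->
  [/\ path e (t uv.1) q, last (t uv.1) q = t uv.2 &
      {subset t uv.1 :: q <= cls uv.1 :|: cls uv.2}])) => -[u v] /=.
case: (boolP (K u v)) => [Kuv|_]; last by exists [::].
have /connectP[p pth lst] := lnk u v Kuv.
move: pth; rewrite within_path ?inE ?t_cls // => /andP[pe /allP pall].
exists p => _; split=> // x; rewrite inE => /predU1P[->|/pall//].
by rewrite inE t_cls.
Qed.

Section CycleModel.
Variables (U V : finType) (K : sgraph U) (e : rel V).
Variables (cls : U -> {set V}) (t : U -> V).
Hypothesis e_sym : symmetric e.
Hypothesis cls_inj : forall u v x, x \in cls u -> x \in cls v -> u = v.
Hypothesis t_cls : forall u, t u \in cls u.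

(** The bag of the [i]-th vertex of the cycle is a prefix of its Kempe path to
    the preceding vertex. Such a path stays in two consecutive classes, so bags
    that are not consecutive are automatically disjoint. *)
Lemma cycle_model c : linked K e cls t -> is_cycle K c ->
  (forall u v, K u v -> [set u; v] \in cycle_edges c) ->
  exists bag, rooted_model K e t bag.
Proof.
move=> lnk [/andP[cyc uc] szc] Kc.
have [w wP] := linked_paths t_cls lnk.
case: c cyc uc szc Kc => // x0 c'; set c := x0 :: c' => cyc uc szc Kc.
pose n := size c'; have n2 : 1 < n by [].
pose vtx := nth x0 c.
pose pr i := if i is j.+1 then j else n.
pose p i := t (vtx i) :: w (vtx i, vtx (pr i)).
have pr_le i : i <= n -> pr i <= n by case: i => //= i /ltnW.
have vtx_c i : i <= n -> vtx i \in c by move=> le; apply: mem_nth.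
have vtx_inj i j : i <= n -> j <= n -> vtx i = vtx j -> i = j.
  by move=> le_i le_j /eqP; rewrite nth_uniq // => /eqP.
have Kpr i : i <= n -> K (vtx i) (vtx (pr i)).
  have /(pathP x0) Kn : path K x0 (rcons c' x0) := cyc.
  rewrite size_rcons in Kn.
  case: i => [|i] le_i; last first.
    have := Kn i (ltnW le_i); rewrite nth_rcons le_i adj_sym.
    by rewrite -rcons_cons nth_rcons /= ltnS ltnW.
  have := Kn n (leqnn _); rewrite nth_rcons ltnn eqxx adj_sym.
  by rewrite -rcons_cons nth_rcons /= ltnSn.
have wpr i (le_i : i <= n) := wP (vtx i, vtx (pr i)) (Kpr i le_i).
have p_cls i j x : i <= n -> j <= n -> x \in p i -> x \in cls (vtx j) ->
    j = i \/ j = pr i.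
  move=> le_i le_j xp xj; have [_ _ /(_ x xp)] := wpr i le_i.
  by rewrite !inE => /orP[] /(cls_inj xj) /vtx_inj; [left|right]; auto.
have p_in i x : i <= n -> x \in p i ->
    x \in cls (vtx i) \/ x \in cls (vtx (pr i)).
  by move=> le_i xp; have [_ _ /(_ x xp)] := wpr i le_i; rewrite !inE => /orP.
have p_end i : i <= n -> t (vtx (pr i)) \in p i.
  by move=> le_i; have [_ /= <- _] := wpr i le_i; apply: mem_last.
have [L [chL clL]] : exists L, closed_chain e n p L.
  apply: (@closed_chain_exists V e n p (t \o vtx)) => //.
  - by move=> i le_i; have [] := wpr i le_i.
  - by move=> i lt_i; apply: (p_end i.+1).
  - exact: (p_end 0).
  - move=> i lt_i; apply/negP => tp.
    have := p_cls i i.+1 _ (ltnW lt_i) lt_i tp (t_cls _).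
    by case: (i) lt_i => [|k] /=; lia.
  - apply/negP => tp; have := p_cls n 0 _ (leqnn _) isT tp (t_cls _).
    by case: (n) n2 => [|k] /=; lia.
  - move=> x x0p x1p; apply/negP => xnp.
    have [xc|xc] := p_in 0 x isT x0p.
      have := p_cls n 0 x (leqnn _) isT xnp xc.
      by case: (n) n2 => [|k] /=; lia.
    by have := p_cls 1 n x (ltnW n2) (leqnn _) x1p xc; rewrite /=; lia.
  - exact: ltnW.
pose B i := take (L i) (p i).
have dis i j : i < j -> j <= n -> ~~ has (mem (B i)) (B j).
  move=> lt_ij le_jn; have le_in := leq_trans (ltnW lt_ij) le_jn.
  apply/negP => meet; case/hasP: (meet) => x /mem_take xj /mem_take xi.
  have [j1|[i0 jn]] : j = i.+1 \/ i = 0 /\ j = n.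
    case: (p_in i x le_in xi) => xc.
      by have [] := p_cls j i x le_jn le_in xj xc; rewrite /pr; case: (j) lt_ij; lia.
    have [] := p_cls j (pr i) x le_jn (pr_le _ le_in) xj xc;
      by rewrite /pr; case: (j) (i) lt_ij le_jn => [|?] [|?]; lia.
  - have lt_in : 0 <= i < n by rewrite -j1.
    by have [/negP dis _] := chL i lt_in; apply: dis; rewrite -j1.
  - by case: clL => /negP dis _; apply: dis; rewrite -{1 2}i0 -jn.
have ne i : i <= n -> 0 < L i.
  have pos : forall x, x \in B i -> 0 < L i by move=> x; rewrite /B; case: (L i).
  rewrite leq_eqVlt => /predU1P[iE|lt_in].
    by case: clL => _ [x [y [_ yn _]]]; apply: (pos y); rewrite /B iE.
  by have [|_ [x [y [xi _ _]]]] := chL i; [rewrite lt_in|apply: (pos x)].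
pose bag u := if u \in c then [set x in B (index u c)] else [set t u].
have idx u : u \in c -> exists2 i, i <= n & u = vtx i.
  by move=> uc'; exists (index u c); rewrite ?/vtx ?nth_index // -ltnS index_mem.
have bagE i : i <= n -> bag (vtx i) = [set x in B i].
  by move=> le_i; rewrite /bag vtx_c // /vtx index_uniq.
have bag_out u : u \notin c -> bag u = [set t u] by rewrite /bag => /negPf->.
have tB i u : i <= n -> u \notin c -> t u \notin B i.
  move=> le_i uc'; apply/negP => /mem_take /(p_in _ _ le_i).
  by case=> /(cls_inj (t_cls u)) uE; move: uc'; rewrite uE vtx_c ?pr_le.
exists bag; split.
- move=> u v uv; rewrite -setI_eq0; apply/eqP/setP => x; rewrite in_setI in_set0.
  case: (boolP (u \in c)) => uc'; case: (boolP (v \in c)) => vc'.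
  + case: (idx u uc') (idx v vc') uv => i le_i -> [j le_j ->] uv.
    rewrite !bagE // !inE; apply/negP => /andP[xi xj].
    have [ij|ij|ij] := ltngtP i j.
    * by case/hasP: (dis i j ij le_j); exists x.
    * by case/hasP: (dis j i ij le_i); exists x.
    * by rewrite ij eqxx in uv.
  + case: (idx u uc') => i le_i ->; rewrite bagE // bag_out // !inE.
    by apply/negP => /andP[xi /eqP xv]; move: (tB i v le_i vc'); rewrite -xv xi.
  + case: (idx v vc') => i le_i ->; rewrite bagE // bag_out // !inE.
    by apply/negP => /andP[/eqP xu xi]; move: (tB i u le_i uc'); rewrite -xu xi.
  + rewrite !bag_out // !inE; apply/negP => /andP[/eqP xu /eqP xv].
    by case/eqP: uv; apply: (@cls_inj u v x); rewrite ?xu ?t_cls // -xu xv t_cls.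
- move=> u; case: (boolP (u \in c)) => uc'; last by rewrite bag_out ?inE.
  case: (idx u uc') => i le_i ->; rewrite bagE // inE /B.
  by case: (L i) (ne i le_i) => //= m _; rewrite mem_head.
- move=> u x; case: (boolP (u \in c)) => uc'.
  2: by rewrite bag_out // inE => /eqP->.
  case: (idx u uc') => i le_i ->; rewrite bagE // inE /B.
  case: (L i) (ne i le_i) => //= m _ xB; apply: path_connect_within xB.
  by apply: take_path; have [] := wpr i le_i.
have nxt i : i <= n -> exists x y,
    [/\ x \in bag (vtx i), y \in bag (next c (vtx i)) & e x y].
  have nextE u : next c u = if u \in c then nth x0 c' (index u c) else u.
    by rewrite next_nth.
  move=> le_i; rewrite nextE vtx_c // [index _ _]index_uniq //.
  move: le_i; rewrite leq_eqVlt => /predU1P[->|lt_in].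
    rewrite nth_default // -[x0]/(vtx 0) !bagE //.
    case: clL => _ [x [y [xi yj exy]]]; exists y, x.
    by rewrite !inE e_sym.
  have -> : nth x0 c' i = vtx i.+1 by [].
  rewrite !bagE //; last exact: ltnW.
  have [|_ [x [y [xi yj exy]]]] := chL i; first by rewrite lt_in.
  by exists x, y; rewrite !inE.
move=> u v Kuv; have /imsetP[z zc eqs] := Kc u v Kuv.
have uv : u != v by apply: contraTneq Kuv => ->; rewrite adj_irr.
have [i le_i zi] := idx z zc; have [x [y [xi yj exy]]] := nxt i le_i.
rewrite -zi in xi yj.
case: (set2_eq uv eqs) => -[-> ->]; first by exists x, y.
by exists y, x; rewrite e_sym.
Qed.

End CycleModel.

(** * Graphs with at most one cycle *)

Lemma linked_model (U V : finType) (K : sgraph U) (e : rel V)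
    (cls : U -> {set V}) (t : U -> V) :
  at_most_one_cycle K -> symmetric e ->
  (forall u v x, x \in cls u -> x \in cls v -> u = v) ->
  (forall u, t u \in cls u) -> linked K e cls t ->
  exists bag, rooted_model K e t bag.
Proof.
have [m] := ubnP #|[set uv | K uv.1 uv.2]|.
elim: m K e => // m IH K e le_m one e_sym cls_inj t_cls lnk.
case: (boolP [exists l, exists s, K l s && [forall v, K l v ==> (v == s)]]).
  case/existsP => l /existsP[s /andP[Kls /forallP leaf]].
  have l_leaf v : K l v -> v = s by move=> Klv; apply/eqP/(implyP (leaf v)).
  have [e' [e'_sym lnk' ext]] := leaf_reduction e_sym cls_inj t_cls lnk Kls l_leaf.
  apply: ext; apply: IH => //; last first.
    have sub : subrel (del_edge K l s) K by move=> u v /andP[].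
    by move=> c d cc cd; apply: one;
      [apply: sub_is_cycle cc|apply: sub_is_cycle cd].
  rewrite -ltnS; apply: leq_trans le_m; apply: proper_card.
  apply/properP; split; first by apply/subsetP => uv; rewrite !inE => /andP[].
  by exists (l, s); rewrite !inE /= ?/del_edge_adj ?Kls // eqxx andbF.
rewrite negb_exists => /forallP no_leaf.
have nl u v : K u v -> exists2 w, K u w & w != v.
  move=> Kuv; have := no_leaf u; rewrite negb_exists => /forallP/(_ v).
  rewrite Kuv negb_forall => /existsP[w]; rewrite negb_imply => /andP[? ?].
  by exists w.
case: (pickP [pred uv | K uv.1 uv.2]) => [[x y] /= Kxy|none].
  have [c cyc Kc] := cycle_of_no_leaf one nl Kxy.
  exact: (cycle_model e_sym cls_inj t_cls lnk cyc Kc).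
exists (fun u => [set t u]); split.
- move=> u v uv; rewrite disjoints1 inE; apply: contra uv => /eqP tuv.
  by apply/eqP/(cls_inj _ _ (t u)); last rewrite tuv.
- by move=> u; rewrite inE.
- by move=> u x; rewrite inE => /eqP->.
- by move=> u v Kuv; have := none (u, v); rewrite /= Kuv.
Qed.

Lemma connect_induced (V : finType) (G : sgraph V) (B : {set V})
    (x y : {x : V | x \in B}) :
  connect (induced G B) x y = connect (within G B) (val x) (val y).
Proof.
apply/idP/idP => /connectP[p].
  move=> pth ->; elim: p x pth => //= z p IH x /andP[xz pz].
  apply: connect_trans (IH z pz); apply: connect1.
  by rewrite /within (valP x) (valP z).
elim: p x => [|z p IH] x /=; first by move=> _ /val_inj->.
case/andP=> /and3P[_ zB xz] pz lst.
apply: (@connect_trans _ _ (Sub z zB)); last exact: IH.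
exact: connect1.
Qed.

Theorem theorem5 (U : finType) (K : sgraph U) :
  at_most_one_cycle K -> property_star K.
Proof.
move=> one V G C T H /andP[partC _] _ trT sub [f [g fK gK] fE].
have [/eqP covC tiC _] := and3P partC.
pose t u := val (f u); pose cls u := pblock C (t u).
have t_inj : injective t by move=> u v /val_inj/(can_inj fK).
have t_cls u : t u \in cls u by rewrite mem_pblock covC inE.
have cls_eq u v : cls u = cls v -> u = v.
  move=> eqc; apply: t_inj; apply: (pblock_inj trT) eqc; exact: valP.
have cls_inj u v x : x \in cls u -> x \in cls v -> u = v.
  by move=> xu xv; apply: cls_eq;
     rewrite /cls -(same_pblock tiC xu) (same_pblock tiC xv).
have lnk : linked K G cls t.
  move=> u v Kuv; have uv : u != v by apply: contraTneq Kuv => ->; rewrite adj_irr.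
  have /sub/andP[_ /existsP[X /and3P[]]] : H (f u) (f v) by rewrite fE.
  case/existsP => A /andP[AC /existsP[B /and3P[BC AB]]].
  case/existsP => Y /andP[/imsetP[z _ ->] /eqP ->] /imsetP[a].
  rewrite inE => za ua /imsetP[b]; rewrite inE => zb vb.
  have ab : connect (induced G (A :|: B)) a b.
    by apply: connect_trans zb; rewrite (sym_connect_sym (@adj_sym _ _)).
  rewrite connect_induced -ua -vb in ab.
  have own w D : D \in C -> t w \in D -> cls w = D.
    by move=> DC; apply: def_pblock.
  suff -> : cls u :|: cls v = A :|: B by [].
  have := valP a; have := valP b; rewrite -ua -vb !inE.
  move=> /orP[] /own vE /orP[] /own uE; rewrite ?vE ?uE // 1?setUC //.
  - by case/eqP: uv; apply: cls_eq; rewrite uE // vE.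
  - by case/eqP: uv; apply: cls_eq; rewrite uE // vE.
have [bag [dis root conn adjc]] := linked_model one (@adj_sym _ G) cls_inj t_cls lnk.
exists (bag \o g); split.
- by move=> s r sr; apply: dis; rewrite (can_eq gK).
- by move=> s; have := root (g s); rewrite /t gK.
- move=> s x y; rewrite connect_induced; apply: (@connect_trans _ _ (t (g s))).
    by rewrite connect_within_sym; [apply: conn (valP x)|apply: adj_sym].
  exact: conn (valP y).
- by move=> s r sr; apply: adjc; rewrite -fE !gK.
Qed.
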